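(* Let $R$ be a commutative noetherian ring, let $C$ be a semidualizing $R$-module, and let $M$ be an $R$-module. If the natural evaluation map $C\otimes_R\operatorname{Hom}_R(C,M)\to M$ is an isomorphism (e.g., if $M\in\mathcal{B}_C(R)$), then $\operatorname{Tor}^{\mathcal{F}_C\mathcal{M}}_0(M,-)\cong M\otimes_R-$.
   Context: $R$ is a commutative noetherian ring. A finitely generated $R$-module $C$ is semidualizing if the homothety map $R\to\operatorname{Hom}_R(C,C)$ is an isomorphism and $\operatorname{Ext}^i_R(C,C)=0$ for all $i\geq 1$. $\mathcal{F}_C(R)$ is the class of $R$-modules isomorphic to $F\otimes_R C$ with $F$ flat; it is precovering. A proper $\mathcal{F}_C$-resolution of $M$ is a complex $G=(\cdots\to G_1\to G_0\to 0)$ with each $G_i\in\mathcal{F}_C(R)$ together with an augmentation $G_0\to M$ such that $G^+=(\cdots\to G_1\to G_0\to M\to 0)$ is a complex (not necessarily exact) and $\operatorname{Hom}_R(Y,G^+)$ is exact for all $Y\in\mathcal{F}_C(R)$. Then $\operatorname{Tor}^{\mathcal{F}_C\mathcal{M}}_i(M,N):=H_i(G\otimes_R N)$, independent of the choice of $G$. The Bass class $\mathcal{B}_C(R)$ is the class of $R$-modules $M$ such that $\operatorname{Ext}^i_R(C,M)=0=\operatorname{Tor}^R_i(C,\operatorname{Hom}_R(C,M))$ for all $i\geq 1$ and the natural evaluation map $C\otimes_R\operatorname{Hom}_R(C,M)\to M$ is an isomorphism. *)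

(* Defs.v *)
From HB Require Import structures.
From mathcomp Require Import all_boot all_order all_algebra.
From mathcomp Require Import boolp.

Set Implicit Arguments.
Unset Strict Implicit.
Unset Printing Implicit Defensive.

Import GRing.Theory.
Local Open Scope ring_scope.
Local Open Scope quotient_scope.

(* R ranges over comPzRingType, so that the zero ring is allowed. *)

Definition mk_linear (R : pzRingType) (U V : lmodType R) (f : U -> V)
    (fL : linear f) : {linear U -> V} :=
  HB.pack f (GRing.isLinear.Build R U V *:%R f fL).

Lemma linear_ext (R : pzRingType) (U V : lmodType R) (f g : {linear U -> V}) :
  f =1 g -> f = g.
Proof.
case: f g => [f [[f1] [f2]]] [g [[g1] [g2]]] /= fg.
have {}fg : f = g by apply: funext.
by subst g; rewrite (Prop_irrelevance f1 g1) (Prop_irrelevance f2 g2).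
Qed.

(* Unlike raddf_sum, does not unfold concrete f when rewriting *)
Lemma lin_sum (R : pzRingType) (U V : lmodType R) (f : {linear U -> V})
    (I : Type) (r : seq I) (F : I -> U) :
  f (\sum_(i <- r) F i) = \sum_(i <- r) f (F i).
Proof. exact: raddf_sum. Qed.

Section HomModule.
Variables (R : comPzRingType) (A B : lmodType R).
Implicit Types f g : {linear A -> B}.

HB.instance Definition _ := gen_eqMixin {linear A -> B}.
HB.instance Definition _ := gen_choiceMixin {linear A -> B}.

Fact hom_zero_linear : linear (fun _ : A => 0 : B).
Proof. by move=> r x y /=; rewrite scaler0 addr0. Qed.
Fact hom_opp_linear f : linear (fun x => - f x).
Proof. by move=> r x y /=; rewrite linearP opprD scalerN. Qed.
Fact hom_add_linear f g : linear (fun x => f x + g x).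
Proof. by move=> r x y /=; rewrite !linearP scalerDr addrACA. Qed.
Fact hom_scale_linear (a : R) f : linear (fun x => a *: f x).
Proof. by move=> r x y /=; rewrite linearP scalerDr !scalerA mulrC. Qed.

Definition hom_zero := mk_linear hom_zero_linear.
Definition hom_opp f := mk_linear (hom_opp_linear f).
Definition hom_add f g := mk_linear (hom_add_linear f g).
Definition hom_scale a f := mk_linear (hom_scale_linear a f).

Fact hom_addA : associative hom_add.
Proof. by move=> f g h; apply: linear_ext => x /=; rewrite addrA. Qed.
Fact hom_addC : commutative hom_add.
Proof. by move=> f g; apply: linear_ext => x /=; rewrite addrC. Qed.
Fact hom_add0 : left_id hom_zero hom_add.
Proof. by move=> f; apply: linear_ext => x /=; rewrite add0r. Qed.
Fact hom_addN : left_inverse hom_zero hom_opp hom_add.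
Proof. by move=> f; apply: linear_ext => x /=; rewrite addNr. Qed.

HB.instance Definition _ := GRing.isZmodule.Build {linear A -> B}
  hom_addA hom_addC hom_add0 hom_addN.

Fact hom_scaleA a b f : hom_scale a (hom_scale b f) = hom_scale (a * b) f.
Proof. by apply: linear_ext => x /=; rewrite scalerA. Qed.
Fact hom_scale1 : left_id 1 hom_scale.
Proof. by move=> f; apply: linear_ext => x /=; rewrite scale1r. Qed.
Fact hom_scaleDr : right_distributive hom_scale +%R.
Proof. by move=> a f g; apply: linear_ext => x /=; rewrite scalerDr. Qed.
Fact hom_scaleDl f : {morph hom_scale^~ f : a b / a + b}.
Proof. by move=> a b; apply: linear_ext => x /=; rewrite scalerDl. Qed.

HB.instance Definition _ := GRing.Zmodule_isLmodule.Build R {linear A -> B}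
  hom_scaleA hom_scale1 hom_scaleDr hom_scaleDl.

Lemma hom0E x : (0 : {linear A -> B}) x = 0. Proof. by []. Qed.
Lemma homNE f x : (- f) x = - f x. Proof. by []. Qed.
Lemma homDE f g x : (f + g) x = f x + g x. Proof. by []. Qed.
Lemma homZE a f x : (a *: f) x = a *: f x. Proof. by []. Qed.

End HomModule.

Section Compositions.
Variables (R : comPzRingType) (A B D : lmodType R).

Fact postcomp_linear (g : {linear B -> D}) :
  linear (fun f : {linear A -> B} => (g \o f : {linear A -> D})).
Proof. by move=> a f f'; apply: linear_ext => x /=; rewrite linearP. Qed.

Fact precomp_linear (f : {linear A -> B}) :
  linear (fun g : {linear B -> D} => (g \o f : {linear A -> D})).
Proof. by move=> a g g'; apply: linear_ext => x. Qed.

(* Hom(A, g) and Hom(f, D) *)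
Definition postcomp g := mk_linear (postcomp_linear g).
Definition precomp f := mk_linear (precomp_linear f).

End Compositions.
Arguments postcomp {R} A {B D} g.
Arguments precomp {R A B} D f.

Section Homothety.
Variables (R : comPzRingType) (C : lmodType R).

Fact homothety_linear :
  linear (fun r : R^o => (r : R) *: (idfun : {linear C -> C})).
Proof.
by move=> a r s; apply: linear_ext => x /=; rewrite scalerDl -scalerA.
Qed.

Definition homothety : {linear R^o -> {linear C -> C}} :=
  mk_linear homothety_linear.

End Homothety.

(* The tensor product: formal sums of pairs (lists, added by concatenation)   *)
(* modulo the congruence generated by bilinearity. Lists only form a monoid,  *)
(* so that 0 (x) b = 0 has to be imposed; it provides the opposites.          *)
Section TensorProduct.
Variables (R : comPzRingType) (A B : lmodType R).

Inductive tens_eq : seq (A * B) -> seq (A * B) -> Prop :=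
| tens_eq_refl s : tens_eq s s
| tens_eq_sym s t : tens_eq s t -> tens_eq t s
| tens_eq_trans s t u : tens_eq s t -> tens_eq t u -> tens_eq s u
| tens_eq_cat s s' t t' :
    tens_eq s s' -> tens_eq t t' -> tens_eq (s ++ t) (s' ++ t')
| tens_eq_catC s t : tens_eq (s ++ t) (t ++ s)
| tens_eq_Dl a a' b : tens_eq [:: (a + a', b)] [:: (a, b); (a', b)]
| tens_eq_Dr a b b' : tens_eq [:: (a, b + b')] [:: (a, b); (a, b')]
| tens_eq_Z r a b : tens_eq [:: (r *: a, b)] [:: (a, r *: b)]
| tens_eq_0 b : tens_eq [:: (0, b)] [::].

Definition tens_rel (s t : seq (A * B)) : bool := `[< tens_eq s t >].

Fact tens_rel_refl : reflexive tens_rel.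
Proof. by move=> s; apply/asboolP/tens_eq_refl. Qed.
Fact tens_rel_sym : symmetric tens_rel.
Proof. by move=> s t; apply/asboolP/asboolP; apply: tens_eq_sym. Qed.
Fact tens_rel_trans : transitive tens_rel.
Proof.
by move=> t s u /asboolP st /asboolP tu; apply/asboolP/(tens_eq_trans st tu).
Qed.

Canonical tens_equiv := EquivRel tens_rel tens_rel_refl tens_rel_sym tens_rel_trans.

Definition tensor := {eq_quot tens_rel}.
HB.instance Definition _ := Choice.on tensor.
HB.instance Definition _ := EqQuotient.on tensor.

Definition sum_of (s : seq (A * B)) : tensor := \pi s.

Lemma sum_of_eq s t : tens_eq s t <-> sum_of s = sum_of t.
Proof.
by split=> [st|/eqmodP/asboolP//]; apply/eqmodP/asboolP.
Qed.

Lemma sum_of_repr x : sum_of (repr x) = x. Proof. exact: reprK. Qed.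

Lemma tens_eq_repr s : tens_eq (repr (sum_of s)) s.
Proof. by apply/sum_of_eq; rewrite sum_of_repr. Qed.

Definition scale_pairs (r : R) (s : seq (A * B)) := [seq (r *: p.1, p.2) | p <- s].

Lemma tens_eq_scale r s t :
  tens_eq s t -> tens_eq (scale_pairs r s) (scale_pairs r t).
Proof.
rewrite /scale_pairs.
elim=> {s t} [s|s t _ h|s t u _ h _ k|s s' t t' _ h _ k|s t|a a' b|a b b'|q a b|b] /=.
- exact: tens_eq_refl.
- exact: tens_eq_sym.
- exact: tens_eq_trans h k.
- by rewrite !map_cat; apply: tens_eq_cat.
- by rewrite !map_cat; apply: tens_eq_catC.
- by rewrite scalerDr; apply: tens_eq_Dl.
- exact: tens_eq_Dr.
- by rewrite scalerA mulrC -scalerA; apply: tens_eq_Z.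
- by rewrite scaler0; apply: tens_eq_0.
Qed.

Definition tensor_zero : tensor := sum_of [::].
Definition tensor_add (x y : tensor) : tensor := sum_of (repr x ++ repr y).
Definition tensor_scale (r : R) (x : tensor) : tensor :=
  sum_of (scale_pairs r (repr x)).
Definition tensor_opp (x : tensor) : tensor := tensor_scale (-1) x.

Lemma tensor_addE s t : tensor_add (sum_of s) (sum_of t) = sum_of (s ++ t).
Proof. by apply/sum_of_eq/tens_eq_cat; apply: tens_eq_repr. Qed.
Lemma tensor_scaleE r s : tensor_scale r (sum_of s) = sum_of (scale_pairs r s).
Proof. by apply/sum_of_eq/tens_eq_scale/tens_eq_repr. Qed.

Fact tensor_addA : associative tensor_add.
Proof.
move=> x y z; rewrite -[x]sum_of_repr -[y]sum_of_repr -[z]sum_of_repr.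
by rewrite !tensor_addE catA.
Qed.
Fact tensor_addC : commutative tensor_add.
Proof. by move=> x y; apply/sum_of_eq/tens_eq_catC. Qed.
Fact tensor_add0 : left_id tensor_zero tensor_add.
Proof. by move=> x; rewrite -[x]sum_of_repr tensor_addE. Qed.

Fact tensor_scaleDl x : {morph tensor_scale^~ x : r q / r + q >-> tensor_add r q}.
Proof.
move=> r q; rewrite -[x]sum_of_repr !tensor_scaleE tensor_addE.
elim: (repr x) => [|p s ih] //.
have E t : sum_of (scale_pairs t (p :: s)) =
    tensor_add (sum_of [:: (t *: p.1, p.2)]) (sum_of (scale_pairs t s)).
  by rewrite tensor_addE.
rewrite -tensor_addE !E ih -tensor_addE scalerDl.
have -> : sum_of [:: (r *: p.1 + q *: p.1, p.2)] =
    tensor_add (sum_of [:: (r *: p.1, p.2)]) (sum_of [:: (q *: p.1, p.2)]).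
  by rewrite tensor_addE; apply/sum_of_eq/tens_eq_Dl.
rewrite -!tensor_addA; congr tensor_add.
by rewrite !tensor_addA; congr tensor_add; exact: tensor_addC.
Qed.

Fact tensor_scale0 x : tensor_scale 0 x = tensor_zero.
Proof.
rewrite -[x]sum_of_repr tensor_scaleE; elim: (repr x) => [|p s ih] //.
rewrite -[LHS]/(sum_of ([:: (0 *: p.1, p.2)] ++ scale_pairs 0 s)).
rewrite -tensor_addE ih scale0r (_ : sum_of _ = tensor_zero) ?tensor_add0 //.
by apply/sum_of_eq/tens_eq_0.
Qed.
Fact tensor_scale1 : left_id 1 tensor_scale.
Proof.
move=> x; rewrite -[x in LHS]sum_of_repr tensor_scaleE -[RHS]sum_of_repr.
congr sum_of; rewrite /scale_pairs -[RHS]map_id; apply: eq_map => -[a b] /=.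
by rewrite scale1r.
Qed.
Fact tensor_addN : left_inverse tensor_zero tensor_opp tensor_add.
Proof.
by move=> x; rewrite -[x in X in tensor_add _ X]tensor_scale1 -tensor_scaleDl
  addNr tensor_scale0.
Qed.

HB.instance Definition _ := GRing.isZmodule.Build tensor
  tensor_addA tensor_addC tensor_add0 tensor_addN.

Fact tensor_scaleA r q x : tensor_scale r (tensor_scale q x) = tensor_scale (r * q) x.
Proof.
rewrite -[x]sum_of_repr !tensor_scaleE /scale_pairs -map_comp.
by congr sum_of; apply: eq_map => -[a b] /=; rewrite scalerA.
Qed.
Fact tensor_scaleDr : right_distributive tensor_scale +%R.
Proof.
move=> r x y; rewrite -[x]sum_of_repr -[y]sum_of_repr.
rewrite [X in tensor_scale r X]tensor_addE !tensor_scaleE.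
by rewrite [RHS]tensor_addE /scale_pairs map_cat.
Qed.

HB.instance Definition _ := GRing.Zmodule_isLmodule.Build R tensor
  tensor_scaleA tensor_scale1 tensor_scaleDr tensor_scaleDl.

Definition tens (a : A) (b : B) : tensor := sum_of [:: (a, b)].

Lemma tensDl a a' b : tens (a + a') b = tens a b + tens a' b.
Proof. by rewrite [RHS]tensor_addE; apply/sum_of_eq/tens_eq_Dl. Qed.
Lemma tensDr a b b' : tens a (b + b') = tens a b + tens a b'.
Proof. by rewrite [RHS]tensor_addE; apply/sum_of_eq/tens_eq_Dr. Qed.
Lemma tensZl r a b : tens (r *: a) b = r *: tens a b.
Proof. by rewrite [RHS]tensor_scaleE. Qed.
Lemma tensZr r a b : tens a (r *: b) = r *: tens a b.
Proof. by rewrite -tensZl; apply/esym/sum_of_eq/tens_eq_Z. Qed.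

Lemma sum_ofE s : sum_of s = \sum_(p <- s) tens p.1 p.2.
Proof.
elim: s => [|[a b] s ih]; first by rewrite big_nil.
by rewrite big_cons -ih; apply/esym/tensor_addE.
Qed.

Lemma tensor_gen x : exists s : seq (A * B), x = \sum_(p <- s) tens p.1 p.2.
Proof. by exists (repr x); rewrite -sum_ofE sum_of_repr. Qed.

Section UniversalProperty.
Variables (W : lmodType R) (h : A -> B -> W).
Hypotheses (hl : forall b, linear (h^~ b)) (hr : forall a, linear (h a)).

Let hZl r a b : h (r *: a) b = r *: h a b.
Proof. exact: (linearZ_LR (mk_linear (hl b))). Qed.
Let hZr r a b : h a (r *: b) = r *: h a b.
Proof. exact: (linearZ_LR (mk_linear (hr a))). Qed.

Lemma tens_eq_bilinear s t : tens_eq s t ->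
  \sum_(p <- s) h p.1 p.2 = \sum_(p <- t) h p.1 p.2.
Proof.
elim=> {s t} [s|s t _ ->|s t u _ -> _ ->|s s' t t' _ e _ e'|s t|a a' b|a b b'|r a b|b] //.
- by rewrite !big_cat /= e e'.
- by rewrite !big_cat /= addrC.
- by rewrite !(big_cons, big_nil) /= !addr0; exact: (raddfD (mk_linear (hl b))).
- by rewrite !(big_cons, big_nil) /= !addr0; exact: (raddfD (mk_linear (hr a))).
- by rewrite !(big_cons, big_nil) /= hZl hZr.
- by rewrite !(big_cons, big_nil) /= addr0; exact: (raddf0 (mk_linear (hl b))).
Qed.

Definition tens_lift_fun (x : tensor) : W := \sum_(p <- repr x) h p.1 p.2.

Lemma tens_lift_sum s : tens_lift_fun (sum_of s) = \sum_(p <- s) h p.1 p.2.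
Proof. exact/tens_eq_bilinear/tens_eq_repr. Qed.

Fact tens_lift_linear : linear tens_lift_fun.
Proof.
move=> r x y; rewrite -[x]sum_of_repr -[y]sum_of_repr.
rewrite [_ *: _]tensor_scaleE [_ + _ in LHS]tensor_addE !tens_lift_sum.
rewrite big_cat big_map /= scaler_sumr; congr (_ + _).
by apply: eq_bigr => p _; rewrite hZl.
Qed.

Definition tens_lift : {linear tensor -> W} := mk_linear tens_lift_linear.

Lemma tens_liftE a b : tens_lift (tens a b) = h a b.
Proof. by rewrite /= tens_lift_sum big_seq1. Qed.

End UniversalProperty.

Lemma tensor_ext (W : lmodType R) (f g : {linear tensor -> W}) :
  (forall a b, f (tens a b) = g (tens a b)) -> f =1 g.
Proof.
move=> fg x; have [s ->] := tensor_gen x; rewrite !raddf_sum.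
by apply: eq_bigr => p _; apply: fg.
Qed.

End TensorProduct.
Arguments tens {R A B} a b.

Section TensorMap.
Variables (R : comPzRingType) (A A' B B' : lmodType R).
Variables (f : {linear A -> A'}) (g : {linear B -> B'}).

Fact tens_map_linear_l b : linear (fun a => tens (f a) (g b)).
Proof. by move=> r x y; rewrite linearP tensDl tensZl. Qed.
Fact tens_map_linear_r a : linear (fun b => tens (f a) (g b)).
Proof. by move=> r x y; rewrite linearP tensDr tensZr. Qed.

Definition tens_map : {linear tensor A B -> tensor A' B'} :=
  tens_lift tens_map_linear_l tens_map_linear_r.

Lemma tens_mapE a b : tens_map (tens a b) = tens (f a) (g b).
Proof. exact: tens_liftE. Qed.

End TensorMap.

Section Evaluation.
Variables (R : comPzRingType) (C M : lmodType R).

Fact ev_linear_l (phi : {linear C -> M}) : linear (fun c => phi c).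
Proof. exact: linearP. Qed.
Fact ev_linear_r (c : C) : linear (fun phi : {linear C -> M} => phi c).
Proof. by []. Qed.

Definition ev : {linear tensor C {linear C -> M} -> M} :=
  tens_lift ev_linear_l ev_linear_r.

Lemma evE c phi : ev (tens c phi) = phi c.
Proof. exact: tens_liftE. Qed.

End Evaluation.
Arguments ev {R} C M.

(* The homology Ker g / Im f at V of U --f--> V --g--> W *)
Section Homology.
Variables (R : comPzRingType) (U V W : lmodType R).
Variables (f : {linear U -> V}) (g : {linear V -> W}).

Definition ker_pred : {pred V} := fun x => g x == 0.

Fact ker_submod_closed : submod_closed ker_pred.
Proof.
split=> [|r x y]; rewrite !unfold_in ?raddf0 // => /eqP gx /eqP gy.
by rewrite linearP gx gy scaler0 addr0.
Qed.
HB.instance Definition _ := GRing.isSubmodClosed.Build R V ker_pred ker_submod_closed.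

Record cycles := Cycle { cycle_val : V; cycle_valP : cycle_val \in ker_pred }.
HB.instance Definition _ := [isSub for cycle_val].
HB.instance Definition _ := [Choice of cycles by <:].
HB.instance Definition _ := [SubChoice_isSubLmodule of cycles by <:].

Definition homologous (x y : cycles) : bool :=
  `[< exists u : U, f u = cycle_val x - cycle_val y >].

Fact homologous_refl : reflexive homologous.
Proof. by move=> x; apply/asboolP; exists 0; rewrite raddf0 subrr. Qed.
Fact homologous_sym : symmetric homologous.
Proof.
by move=> x y; apply/asboolP/asboolP => -[u e]; exists (- u); rewrite (raddfN f) /= e opprB.
Qed.
Fact homologous_trans : transitive homologous.
Proof.
move=> y x z /asboolP[u e] /asboolP[v e']; apply/asboolP; exists (u + v).
by rewrite (raddfD f) /= e e' addrA subrK.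
Qed.

Canonical homologous_equiv :=
  EquivRel homologous homologous_refl homologous_sym homologous_trans.

Definition homology := {eq_quot homologous}.
HB.instance Definition _ := Choice.on homology.
HB.instance Definition _ := EqQuotient.on homology.

Definition hclass (x : cycles) : homology := \pi x.

Lemma hclass_eq x y :
  hclass x = hclass y <-> exists u : U, f u = cycle_val x - cycle_val y.
Proof. by split=> [/eqmodP/asboolP|h]//; apply/eqmodP/asboolP. Qed.

Lemma hclass_repr x : hclass (repr x) = x. Proof. exact: reprK. Qed.

Definition homology_zero : homology := hclass 0.
Definition homology_opp (x : homology) : homology := hclass (- repr x).
Definition homology_add (x y : homology) : homology := hclass (repr x + repr y).
Definition homology_scale (r : R) (x : homology) : homology := hclass (r *: repr x).

Lemma homology_oppE x : homology_opp (hclass x) = hclass (- x).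
Proof.
have /hclass_eq[u e] := hclass_repr (hclass x).
by apply/hclass_eq; exists (- u); rewrite (raddfN f) /= e /= opprB opprK addrC.
Qed.
Lemma homology_addE x y : homology_add (hclass x) (hclass y) = hclass (x + y).
Proof.
have /hclass_eq[u e] := hclass_repr (hclass x).
have /hclass_eq[v e'] := hclass_repr (hclass y).
by apply/hclass_eq; exists (u + v); rewrite (raddfD f) /= e e' /= opprD addrACA.
Qed.
Lemma homology_scaleE r x : homology_scale r (hclass x) = hclass (r *: x).
Proof.
have /hclass_eq[u e] := hclass_repr (hclass x).
by apply/hclass_eq; exists (r *: u); rewrite (linearZ_LR f) /= e /= scalerBr.
Qed.

Fact homology_addA : associative homology_add.
Proof.
move=> x y z; rewrite -[x]hclass_repr -[y]hclass_repr -[z]hclass_repr.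
by rewrite !homology_addE addrA.
Qed.
Fact homology_addC : commutative homology_add.
Proof. by move=> x y; rewrite /homology_add addrC. Qed.
Fact homology_add0 : left_id homology_zero homology_add.
Proof. by move=> x; rewrite -[x]hclass_repr homology_addE add0r. Qed.
Fact homology_addN : left_inverse homology_zero homology_opp homology_add.
Proof.
by move=> x; rewrite -[x]hclass_repr homology_oppE homology_addE addNr.
Qed.

HB.instance Definition _ := GRing.isZmodule.Build homology
  homology_addA homology_addC homology_add0 homology_addN.

Fact homology_scaleA r q x :
  homology_scale r (homology_scale q x) = homology_scale (r * q) x.
Proof. by rewrite -[x]hclass_repr !homology_scaleE scalerA. Qed.
Fact homology_scale1 : left_id 1 homology_scale.
Proof. by move=> x; rewrite -[x]hclass_repr homology_scaleE scale1r. Qed.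
Fact homology_scaleDr : right_distributive homology_scale +%R.
Proof.
move=> r x y; rewrite -[x]hclass_repr -[y]hclass_repr ![_ + _]homology_addE.
by rewrite !homology_scaleE [RHS]homology_addE scalerDr.
Qed.
Fact homology_scaleDl x : {morph homology_scale^~ x : r q / r + q}.
Proof.
move=> r q; rewrite -[x]hclass_repr !homology_scaleE [RHS]homology_addE.
by rewrite scalerDl.
Qed.

HB.instance Definition _ := GRing.Zmodule_isLmodule.Build R homology
  homology_scaleA homology_scale1 homology_scaleDr homology_scaleDl.

Fact hclass_linear : linear hclass.
Proof. by move=> r x y; rewrite [r *: hclass x]homology_scaleE [RHS]homology_addE. Qed.

End Homology.
Arguments Cycle {R V W g} cycle_val cycle_valP.
Arguments hclass {R U V W f g} x.

Section HomologyMap.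
Variables (R : comPzRingType) (U V W U' V' W' : lmodType R).
Variables (f : {linear U -> V}) (g : {linear V -> W}).
Variables (f' : {linear U' -> V'}) (g' : {linear V' -> W'}).
Variables (u : {linear U -> U'}) (v : {linear V -> V'}) (w : {linear W -> W'}).
Hypotheses (vf : forall x, v (f x) = f' (u x)) (wg : forall x, w (g x) = g' (v x)).

Fact cycle_map_subproof (x : cycles g) : v (cycle_val x) \in ker_pred g'.
Proof.
by have /eqP e := cycle_valP x; rewrite unfold_in -wg e raddf0.
Qed.
Definition cycle_map (x : cycles g) : cycles g' := Cycle (v (cycle_val x)) (cycle_map_subproof x).

Definition homology_map_fun (x : homology f g) : homology f' g' :=
  hclass (cycle_map (repr x)).

Lemma homology_map_class x : homology_map_fun (hclass x) = hclass (cycle_map x).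
Proof.
have /hclass_eq[a e] := hclass_repr (hclass x : homology f g).
by apply/hclass_eq; exists (u a); rewrite -vf e raddfB.
Qed.

Fact homology_map_linear : linear homology_map_fun.
Proof.
move=> r x y; rewrite -[x]hclass_repr -[y]hclass_repr -hclass_linear.
rewrite !homology_map_class -hclass_linear; congr hclass.
by apply: val_inj; rewrite /= linearP.
Qed.

Definition homology_map : {linear homology f g -> homology f' g'} :=
  mk_linear homology_map_linear.

Lemma homology_mapE x : homology_map (hclass x) = hclass (cycle_map x).
Proof. exact: homology_map_class. Qed.

End HomologyMap.

(* Chain complexes ... -> X 1 -> X 0 -> 0 *)
Record complex (R : comPzRingType) := Complex {
  cobj :> nat -> lmodType R;
  cdiff : forall n, {linear cobj n.+1 -> cobj n};
  cdiffK : forall n x, cdiff n (cdiff n.+1 x) = 0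
}.

Section Complexes.
Variable R : comPzRingType.

(* The differential out of degree n; the zero map in degree 0, where the      *)
(* target X 0.-1 = X 0 plays no role.                                         *)
Definition cout (X : complex R) n : {linear X n -> X n.-1} :=
  match n with 0 => 0 | m.+1 => cdiff X m end.

Definition exact_complex (X : complex R) :=
  forall n (x : X n), cout X n x = 0 -> exists y, cdiff X n y = x.

Definition Hn n (X : complex R) : lmodType R := homology (cdiff X n) (cout X n).

Record chain_map (X Y : complex R) := ChainMap {
  cmap :> forall n, {linear X n -> Y n};
  cmapK : forall n x, cmap n (cdiff X n x) = cdiff Y n (cmap n.+1 x)
}.

Fact cout_map X Y (phi : chain_map X Y) n x :
  phi n.-1 (cout X n x) = cout Y n (phi n x).
Proof. by case: n x => [|n] x /=; rewrite ?raddf0 ?cmapK. Qed.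

Definition Hn_map n X Y (phi : chain_map X Y) : {linear Hn n X -> Hn n Y} :=
  homology_map (@cmapK X Y phi n) (@cout_map X Y phi n).

(* The augmented complex ... -> X 1 -> X 0 -> M -> 0, with M in degree 0 *)
Section Augmented.
Variables (X : complex R) (M : lmodType R) (eps : {linear X 0 -> M}).
Hypothesis epsK : forall x, eps (cdiff X 0 x) = 0.

Definition aug_obj n : lmodType R := if n is m.+1 then X m else M.
Definition aug_diff n : {linear aug_obj n.+1 -> aug_obj n} :=
  match n with 0 => eps | m.+1 => cdiff X m end.
Fact aug_diffK n x : aug_diff n (aug_diff n.+1 x) = 0.
Proof. by case: n x => [|n] x; [apply: epsK | apply: cdiffK]. Qed.
Definition augmented := Complex aug_diffK.
End Augmented.

Section HomComplex.
Variables (Y : lmodType R) (X : complex R).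
Fact hom_diffK n f : postcomp Y (cdiff X n) (postcomp Y (cdiff X n.+1) f) = 0.
Proof. by apply: linear_ext => x; apply: cdiffK. Qed.
Definition hom_complex := @Complex R (fun n => {linear Y -> X n}) _ hom_diffK.
End HomComplex.

Section TensorComplex.
Variable X : complex R.

Fact tensor_diffK (N : lmodType R) n x :
  tens_map (cdiff X n) (idfun : {linear N -> N})
    (tens_map (cdiff X n.+1) (idfun : {linear N -> N}) x) = 0.
Proof.
have [s ->] := tensor_gen x; rewrite !lin_sum big1 // => p _.
by rewrite !tens_mapE cdiffK -(scale0r 0) tensZl scale0r.
Qed.
Definition tensor_complex N :=
  @Complex R (fun n => tensor (X n) N) _ (@tensor_diffK N).

Fact tensor_cmapK (N N' : lmodType R) (f : {linear N -> N'}) n x :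
  tens_map idfun f (cdiff (tensor_complex N) n x) =
  cdiff (tensor_complex N') n (tens_map idfun f x).
Proof.
have [s ->] := tensor_gen x; rewrite !lin_sum; apply: eq_bigr => p _.
by rewrite !tens_mapE.
Qed.
Definition tensor_cmap (N N' : lmodType R) (f : {linear N -> N'}) :
    chain_map (tensor_complex N) (tensor_complex N') :=
  @ChainMap (tensor_complex N) (tensor_complex N')
    (fun n => tens_map idfun f) (tensor_cmapK f).
End TensorComplex.

End Complexes.
Arguments cout {R} X n.

Section ModuleProperties.
Variable R : comPzRingType.
Implicit Types A B C F M N P X Y : lmodType R.

Definition is_ideal (I : R -> Prop) :=
  [/\ I 0, forall x y, I x -> I y -> I (x + y) & forall r x, I x -> I (r * x)].

Definition noetherian := forall I : R -> Prop, is_ideal I ->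
  exists s : seq R, forall x, I x <->
    exists c : 'I_(size s) -> R, x = \sum_i c i * s`_i.

Definition finitely_generated M :=
  exists s : seq M, forall x,
    exists c : 'I_(size s) -> R, x = \sum_i c i *: s`_i.

Definition flat F := forall A B (f : {linear A -> B}),
  injective f -> injective (tens_map f (idfun : {linear F -> F})).

Definition projective P := forall A B (g : {linear A -> B}),
  (forall b, exists a, g a = b) ->
  forall f : {linear P -> B}, exists h : {linear P -> A}, forall x, g (h x) = f x.

Definition isomorphic A B := exists f : {linear A -> B}, bijective f.

Record projective_resolution A := ProjectiveResolution {
  pres :> complex R;
  pres_proj : forall n, projective (pres n);
  pres_aug : {linear pres 0 -> A};
  pres_augK : forall x, pres_aug (cdiff pres 0 x) = 0;
  pres_exact : exact_complex (augmented pres_augK)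
}.

(* Ext^i(A, B) and Tor_i(A, B) computed from a projective resolution of A. In *)
(* degree 0 the incoming map is precomp B 0 = 0.                              *)
Definition Ext A (P : projective_resolution A) i B : lmodType R :=
  homology (precomp B (cout P i)) (precomp B (cdiff P i)).

Definition Tor A (P : projective_resolution A) i B : lmodType R :=
  Hn i (tensor_complex P B).

Definition Ext_vanishes i A B :=
  forall (P : projective_resolution A) (x : Ext P i B), x = 0.

Definition Tor_vanishes i A B :=
  forall (P : projective_resolution A) (x : Tor P i B), x = 0.

Definition semidualizing C :=
  [/\ finitely_generated C,
      bijective (homothety C) &
      forall i, (0 < i)%N -> Ext_vanishes i C C].

Definition F_class C X := exists F, flat F /\ isomorphic (tensor F C) X.

Definition Bass_class C M :=
  [/\ forall i, (0 < i)%N -> Ext_vanishes i C M,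
      forall i, (0 < i)%N -> Tor_vanishes i C {linear C -> M} &
      bijective (ev C M)].

Record proper_F_resolution C M := ProperFResolution {
  fres :> complex R;
  fres_F : forall n, F_class C (fres n);
  fres_aug : {linear fres 0 -> M};
  fres_augK : forall x, fres_aug (cdiff fres 0 x) = 0;
  fres_proper :
    forall Y, F_class C Y -> exact_complex (hom_complex Y (augmented fres_augK))
}.

(* Tor^{F_C M}_i(M, -) computed from a proper F_C-resolution G of M *)
Definition Tor_F C M (G : proper_F_resolution C M) i N : lmodType R :=
  Hn i (tensor_complex G N).

Definition Tor_F_map C M (G : proper_F_resolution C M) i N N'
    (f : {linear N -> N'}) : {linear Tor_F G i N -> Tor_F G i N'} :=
  Hn_map i (tensor_cmap G f).

(* Naturally isomorphic functors, given by their actions on objects and maps *)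
Definition functors_isomorphic
    (S : lmodType R -> lmodType R)
    (Smap : forall N N', {linear N -> N'} -> {linear S N -> S N'})
    (T : lmodType R -> lmodType R)
    (Tmap : forall N N', {linear N -> N'} -> {linear T N -> T N'}) :=
  exists tau : forall N, {linear S N -> T N},
    (forall N, bijective (tau N)) /\
    (forall N N' (f : {linear N -> N'}) x,
       tau N' (Smap N N' f x) = Tmap N N' f (tau N x)).

End ModuleProperties.
Arguments functors_isomorphic {R} S Smap T Tmap.

(* Main.v *)
Require Import Defs.
From mathcomp Require Import all_boot all_order all_algebra.
From mathcomp Require Import boolp.

(** Write [X] for the proper resolution and [eps : X 0 -> M] for its
    augmentation.  As [Tor_0] is the cokernel of [X 1 (x) N -> X 0 (x) N] and
    tensoring is right exact, everything reduces to the exactness of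
    [X 1 -> X 0 -> M -> 0], which is not part of the definition of a proper
    resolution.

    It follows from two facts about the evaluation maps.  The module [C] lies in
    its own class (it is [R (x) C]), so [Hom(C, -)] turns the augmented
    resolution into an exact complex.  Now
    - [eps] is onto ([proper_aug_surj]): the map [ev C M] is onto, so every
      element of [M] is a sum of values of maps [C -> M], and these maps
      lift to [X 0];
    - [Ker eps] is contained in the image of [X 1] ([proper_aug_ker]): the map
      [ev C (X 0)] is onto, because in [F (x) C] each [f (x) c] is the value at
      [c] of the map [f (x) -].  So an element of [Ker eps] comes from
      [C (x) Hom(C, X 0)]; its image in [C (x) Hom(C, M)] vanishes because
      [ev C M] is injective; by right exactness it comes from
      [C (x) Hom(C, X 1)], and evaluating there gives the preimage in [X 1]. *)

Set Implicit Arguments.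
Unset Strict Implicit.
Unset Printing Implicit Defensive.

Import GRing.Theory.
Local Open Scope ring_scope.

(** Unlike [raddfD] and [raddfB], these do not unfold a concrete [f] when
    rewriting. *)
Lemma lin_add (R : pzRingType) (U V : lmodType R) (f : {linear U -> V}) x y :
  f (x + y) = f x + f y.
Proof. exact: raddfD. Qed.

Lemma lin_sub (R : pzRingType) (U V : lmodType R) (f : {linear U -> V}) x y :
  f (x - y) = f x - f y.
Proof. exact: raddfB. Qed.

(** * Right exactness of the tensor product *)

Section RightExactness.
Variables (R : comPzRingType) (U V W N : lmodType R).
Variables (f : {linear U -> V}) (g : {linear V -> W}).
Hypothesis g_surj : forall w, exists v, g v = w.

Lemma tens_map_surj (z : tensor W N) :
  exists y, tens_map g (idfun : {linear N -> N}) y = z.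
Proof.
have [s ->] := tensor_gen z; elim: s => [|[w n] s [y yE]].
  by exists 0; rewrite big_nil raddf0.
have [v vE] := g_surj w.
by exists (tens v n + y); rewrite big_cons lin_add yE tens_mapE vE.
Qed.

Hypothesis gf_exact : forall v, g v = 0 -> exists u, f u = v.

(** Right exactness of [- (x) N]: sending [(g v, n)] to the class of [v (x) n] is
    well defined by exactness, which makes [V (x) N -> Coker (f (x) N)] factor
    through [g (x) N].  The cokernel is taken to be the homology at [V (x) N] of
    [f (x) N] followed by [0]. *)
Lemma tens_map_ker (z : tensor V N) :
  tens_map g (idfun : {linear N -> N}) z = 0 ->
  exists y, tens_map f (idfun : {linear N -> N}) y = z.
Proof.
pose fN := tens_map f (idfun : {linear N -> N}).
pose zN : {linear tensor V N -> tensor V N} := 0.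
have cyc (x : tensor V N) : x \in ker_pred zN by rewrite unfold_in eqxx.
pose cls_fun (x : tensor V N) : homology fN zN := hclass (Cycle x (cyc x)).
have cls_lin : linear cls_fun.
  by move=> r x y; rewrite -hclass_linear; congr hclass; apply: val_inj.
pose cls := mk_linear cls_lin.
have cls0 x : cls x = 0 -> exists y, fN y = x.
  by move/hclass_eq => [y yE]; exists y; rewrite yE subr0.
have im0 y : cls (fN y) = 0 by apply/hclass_eq; exists y; rewrite subr0.
pose sec w := sval (cid (g_surj w)).
have secK w : g (sec w) = w by rewrite /sec; case: cid.
(* by linearity, since [v - v'] lies in the image of [f] *)
have clsE v v' n : g v = g v' -> cls (tens v n) = cls (tens v' n).
  move=> e; have [|u uE] := gf_exact (v := v - v').
    by rewrite lin_sub e subrr.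
  have -> : v = f u + v' by rewrite uE subrK.
  rewrite tensDl lin_add.
  have -> : tens (f u) n = fN (tens u n) by rewrite tens_mapE.
  by rewrite (im0 (tens u n)) add0r.
have hl n : linear (fun w => cls (tens (sec w) n)).
  move=> r w w'; rewrite -linearP -tensZl -tensDl.
  by apply: clsE; rewrite linearP !secK.
have hr w : linear (fun n => cls (tens (sec w) n)).
  by move=> r n n'; rewrite tensDr tensZr linearP.
pose back := tens_lift hl hr.
have backK : back \o tens_map g (idfun : {linear N -> N}) =1 cls.
  apply: tensor_ext => v n.
  rewrite -[LHS]/(back (tens_map g (idfun : {linear N -> N}) (tens v n))).
  by rewrite tens_mapE tens_liftE; apply: clsE; rewrite secK.
by move=> gz; apply: cls0; rewrite -backK -(raddf0 back) -gz.
Qed.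

End RightExactness.

(** * Flatness of the base ring *)

Section CinItsClass.
Variable R : comPzRingType.

Section Unitor.
Variable A : lmodType R.

Fact runit_linear_l (r : R^o) : linear (fun a : A => (r : R) *: a).
Proof. by move=> q a b; rewrite scalerDr !scalerA mulrC. Qed.
Fact runit_linear_r (a : A) : linear (fun r : R^o => (r : R) *: a).
Proof. by move=> q r s; rewrite scalerDl -scalerA. Qed.
Definition runit : {linear tensor A R^o -> A} :=
  tens_lift runit_linear_l runit_linear_r.

Lemma runitK : cancel runit (fun a => tens a (1 : R^o)).
Proof.
move=> x; have [s ->] := tensor_gen x.
elim: s => [|[a r] s ih]; first by rewrite big_nil raddf0 -(scale0r 0) tensZl scale0r.
rewrite big_cons lin_add tensDl ih; congr (_ + _).
by rewrite tens_liftE tensZl -tensZr /GRing.scale /= mulr1.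
Qed.

Definition lunit : {linear tensor R^o A -> A} :=
  tens_lift runit_linear_r runit_linear_l.

Lemma lunit_bij : bijective lunit.
Proof.
exists (fun a => tens (1 : R^o) a) => [x|a]; last first.
  by rewrite tens_liftE scale1r.
have [s ->] := tensor_gen x.
elim: s => [|[r a] s ih]; first by rewrite big_nil raddf0 -(scale0r 0) tensZr scale0r.
rewrite big_cons lin_add tensDr ih; congr (_ + _).
by rewrite tens_liftE tensZr -tensZl /GRing.scale /= mulr1.
Qed.

End Unitor.

Lemma flat_regular : flat (R^o : lmodType R).
Proof.
move=> A B f f_inj x y e; apply: (can_inj (@runitK A)); apply: f_inj.
have runit_nat z : f (runit A z) = runit B (tens_map f idfun z).
  have [s ->] := tensor_gen z.
  rewrite (lin_sum (runit A)) (lin_sum (tens_map _ _)) (lin_sum f) lin_sum.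
  by apply: eq_bigr => p _; rewrite tens_mapE !tens_liftE (linearZ_LR f).
by rewrite !runit_nat e.
Qed.

Lemma F_class_self (C : lmodType R) : F_class C C.
Proof.
by exists R^o; split; [exact: flat_regular | exists (lunit C); exact: lunit_bij].
Qed.

End CinItsClass.

(** * Evaluation maps *)

Section Evaluation.
Variables (R : comPzRingType) (C : lmodType R).

Definition tens_swap (A B : lmodType R) : {linear tensor A B -> tensor B A} :=
  tens_lift (h := fun a b => tens b a)
    (fun b r a a' => etrans (tensDr b (r *: a) a') (congr1 (+%R^~ _) (tensZr r b a)))
    (fun a r b b' => etrans (tensDl (r *: b) b' a) (congr1 (+%R^~ _) (tensZl r b a))).

Lemma tens_swapE (A B : lmodType R) (a : A) (b : B) :
  tens_swap A B (tens a b) = tens b a.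
Proof. exact: tens_liftE. Qed.

Lemma tens_swapK (A B : lmodType R) : cancel (tens_swap A B) (tens_swap B A).
Proof.
move=> x; have [s ->] := tensor_gen x.
rewrite (lin_sum (tens_swap A B)) lin_sum.
by apply: eq_bigr => p _; rewrite !tens_swapE.
Qed.

(** Evaluation with the Hom factor on the left, the side on which right
    exactness is stated. *)
Definition ev_swap (X : lmodType R) : {linear tensor {linear C -> X} C -> X} :=
  ev C X \o tens_swap _ _.

Lemma ev_swapE (X : lmodType R) (phi : {linear C -> X}) c : ev_swap X (tens phi c) = phi c.
Proof. by rewrite -[LHS]/(ev C X (tens_swap _ _ (tens phi c))) tens_swapE evE. Qed.

Lemma ev_swap_nat (X Y : lmodType R) (g : {linear X -> Y}) x :
  ev_swap Y (tens_map (postcomp C g) (idfun : {linear C -> C}) x) =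
  g (ev_swap X x).
Proof.
have [s ->] := tensor_gen x.
rewrite (lin_sum (ev_swap X)) (lin_sum (tens_map _ _)) (lin_sum g) lin_sum.
by apply: eq_bigr => p _; rewrite tens_mapE !ev_swapE.
Qed.

Lemma ev_swap_bij (X : lmodType R) : bijective (ev C X) -> bijective (ev_swap X).
Proof.
by move=> ev_bij; apply: bij_comp ev_bij _; exists (tens_swap _ _); apply: tens_swapK.
Qed.

(** In [F (x) C], the element [a (x) c] is the value at [c] of [a (x) -]. *)
Lemma ev_swap_F_class (X : lmodType R) : F_class C X -> forall x, exists t, ev_swap X t = x.
Proof.
move=> [F [_ [k [k' kK k'K]]]] x; have [s sE] := tensor_gen (k' x).
rewrite -[x]k'K sE; elim: s {sE} => [|[a c] s [t tE]].
  by exists 0; rewrite big_nil !raddf0.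
have phiL : linear (fun c => k (tens a c)).
  by move=> r b b'; rewrite tensDr tensZr linearP.
exists (tens (mk_linear phiL) c + t).
by rewrite big_cons !lin_add -tE ev_swapE.
Qed.

End Evaluation.

(** * Exactness of a proper resolution in low degrees *)

Section ProperResolution.
Variables (R : comPzRingType) (C M : lmodType R).
Hypothesis ev_bij : bijective (ev C M).
Variable G : proper_F_resolution C M.

(** In the next two lemmas [Y := C] is put into the properness condition, in
    degrees [0] and [1] of the augmented complex. *)
Lemma hom_aug_surj (phi : {linear C -> M}) :
  exists psi, postcomp C (fres_aug G) psi = phi.
Proof. exact: (fres_proper (F_class_self C) (n := 0) (x := phi)). Qed.

Lemma hom_aug_ker (psi : {linear C -> G 0}) :
  postcomp C (fres_aug G) psi = 0 -> exists chi, postcomp C (cdiff G 0) chi = psi.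
Proof. exact: (fres_proper (F_class_self C) (n := 1) (x := psi)). Qed.

Lemma proper_aug_surj m : exists x, fres_aug G x = m.
Proof.
have [ev' _ ev'K] := ev_swap_bij ev_bij.
have [t tE] := tens_map_surj hom_aug_surj (ev' m).
by exists (ev_swap C (G 0) t); rewrite -ev_swap_nat tE ev'K.
Qed.

(** A preimage [t] of [x] under evaluation is sent to [0] in [Hom(C, M) (x) C],
    because evaluation is injective there; so [t] comes from
    [Hom(C, G 1) (x) C], and evaluation is natural. *)
Lemma proper_aug_ker x : fres_aug G x = 0 -> exists y, cdiff G 0 y = x.
Proof.
have [t <-] := ev_swap_F_class (fres_F G 0) x.
rewrite -ev_swap_nat => e.
have [|t' <-] := tens_map_ker hom_aug_surj hom_aug_ker (z := t).
  by apply: (bij_inj (ev_swap_bij ev_bij)); rewrite e raddf0.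
by exists (ev_swap C (G 1) t'); rewrite -ev_swap_nat.
Qed.

(** * Comparison of Tor in degree zero with the tensor product *)

Section Comparison.
Variable N : lmodType R.
Let augN := tens_map (fres_aug G) (idfun : {linear N -> N}).

Lemma aug_tensK x : augN (cdiff (tensor_complex G N) 0 x) = 0.
Proof.
have [s ->] := tensor_gen x; rewrite !lin_sum big1 // => p _.
by rewrite !tens_mapE fres_augK -(scale0r 0) tensZl scale0r.
Qed.

Definition Tor0_fun (x : Tor_F G 0 N) : tensor M N := augN (cycle_val (repr x)).

Lemma Tor0_funE c : Tor0_fun (hclass c) = augN (cycle_val c).
Proof.
have /hclass_eq[u e] := hclass_repr (hclass c : Tor_F G 0 N).
by apply/eqP; rewrite -subr_eq0 -lin_sub -e aug_tensK.
Qed.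

Fact Tor0_linear : linear Tor0_fun.
Proof.
move=> r x y; rewrite -[x]hclass_repr -[y]hclass_repr -hclass_linear.
by rewrite !Tor0_funE linearP.
Qed.
Definition Tor0_map := mk_linear Tor0_linear.

Lemma Tor0_bij : bijective Tor0_map.
Proof.
have cyc x : x \in ker_pred (cout (tensor_complex G N) 0).
  by rewrite unfold_in eqxx.
pose sec z := sval (cid (tens_map_surj (N := N) proper_aug_surj z)).
have secK z : augN (sec z) = z by rewrite /sec; case: cid.
exists (fun z => hclass (Cycle (sec z) (cyc _))) => [x|z]; last first.
  exact: etrans (Tor0_funE (Cycle (sec z) (cyc _))) (secK z).
rewrite -[x]hclass_repr; apply/hclass_eq.
apply: (tens_map_ker proper_aug_surj proper_aug_ker).
rewrite lin_sub; apply/eqP; rewrite subr_eq0; apply/eqP.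
exact: etrans (secK _) (Tor0_funE _).
Qed.

End Comparison.
End ProperResolution.

Theorem proposition4p2 (R : comPzRingType) (noethR : noetherian R)
    (C : lmodType R) (semidualC : semidualizing C) (M : lmodType R) :
  (bijective (ev C M) ->
   forall G : proper_F_resolution C M,
     functors_isomorphic
       (Tor_F G 0) (fun N N' (f : {linear N -> N'}) => Tor_F_map G 0 f)
       (tensor M) (fun N N' (f : {linear N -> N'}) =>
                     tens_map (idfun : {linear M -> M}) f)) /\
  (Bass_class C M -> bijective (ev C M)).
Proof.
split=> [ev_bij G|[]//]; exists (Tor0_map G); split=> [N|N N' f x].
  exact: Tor0_bij.
rewrite -[x]hclass_repr /Tor_F_map /Hn_map homology_mapE.
set c := repr x.
rewrite -[LHS]/(Tor0_fun (hclass _)) -[Tor0_map _ _ _]/(Tor0_fun (hclass c)).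
rewrite !Tor0_funE.
rewrite -[cycle_val _ in LHS]/(tens_map idfun f (cycle_val c)).
have [s ->] := tensor_gen (cycle_val c).
rewrite (lin_sum (tens_map idfun f)) !(lin_sum (tens_map (fres_aug G) _)) lin_sum.
by apply: eq_bigr => p _; rewrite !tens_mapE.
Qed.
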